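(* Let $A$ be a square real matrix. The following are equivalent: (i) $A$ is a nonsingular w.d.d. M-matrix. (ii) $A$ is a nonsingular w.d.d. L-matrix. (iii) $A$ is a w.c.d.d. L-matrix.
   Context: An M-matrix is a square matrix $A$ that can be written $A=sI-B$ where $B$ is an entrywise nonnegative matrix and $s\ge\rho(B)$, with $\rho(B)$ the spectral radius of $B$. A Z-matrix is a real matrix with nonpositive off-diagonal entries. An L-matrix is a Z-matrix with positive diagonal entries. A square complex matrix $A=(a_{ij})$ is weakly diagonally dominant (w.d.d.) if $|a_{ii}|\ge\sum_{j\ne i}|a_{ij}|$ for every $i$. For a w.d.d. matrix $A$ of order $m$, let $J(A)=\{1\le i\le m: |a_{ii}|>\sum_{j\neq i}|a_{ij}|\}$. The digraph of $A$ has vertex set $\{1,\dots,m\}$ and an edge $i\to j$ if and only if $a_{ij}\ne 0$; a walk is a nonempty finite sequence of consecutive edges $i_1\to i_2\to\cdots\to i_\ell$ ($\ell\ge2$). Let $P_i(A)$ be the set of walks in the digraph of $A$ whose first vertex is $i$ and whose last vertex lies in $J(A)$. A square complex matrix $A$ is weakly chained diagonally dominant (w.c.d.d.) if $A$ is w.d.d., $J(A)$ is nonempty, and for each $i\notin J(A)$ the set $P_i(A)$ is nonempty. *)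

(* Defs.v *)
From HB Require Import structures.
From mathcomp Require Import all_boot all_order all_algebra.
From mathcomp Require Import complex.
From mathcomp Require Import classical_sets reals.

Set Implicit Arguments.
Unset Strict Implicit.
Unset Printing Implicit Defensive.

Import Order.TTheory GRing.Theory Num.Theory.

Local Open Scope classical_set_scope.
Local Open Scope ring_scope.
Local Open Scope complex_scope.

Section SpectralRadius.
Variable R : realType.

Definition spectral_radius (n : nat) (B : 'M[R[i]]_n) : R :=
  sup [set Normc.normc l | l in [set l : R[i] | eigenvalue B l]].

(* The eigenvalues of a real matrix are taken over the complex numbers. *)
Definition M_matrix (n : nat) (A : 'M[R]_n) : Prop :=
  exists (s : R) (B : 'M[R]_n),
    [/\ A = s%:M - B,
        forall i j, 0 <= B i j
      & spectral_radius (map_mx (real_complex R) B) <= s].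

Definition Z_matrix (n : nat) (A : 'M[R]_n) : Prop :=
  forall i j, i != j -> A i j <= 0.

Definition L_matrix (n : nat) (A : 'M[R]_n) : Prop :=
  Z_matrix A /\ forall i, 0 < A i i.

End SpectralRadius.

(* Stated over an arbitrary numDomainType, so as to cover both real and complex
   matrices. *)
Section DiagonalDominance.
Variables (K : numDomainType) (n : nat).
Implicit Types A : 'M[K]_n.

Definition wdd A : Prop :=
  forall i, \sum_(j < n | j != i) `|A i j| <= `|A i i|.

Definition J A : {set 'I_n} :=
  [set i | \sum_(j < n | j != i) `|A i j| < `|A i i|]%SET.

Definition digraph A : rel 'I_n := fun i j => A i j != 0.

(* Walks are given by their full vertex sequence; as they have at least two
   vertices, the default value i of head and last is never used. *)
Definition walks_to_J A (i : 'I_n) : set (seq 'I_n) :=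
  [set w | [/\ (2 <= size w)%N, sorted (digraph A) w,
               head i w = i & last i w \in J A]].

Definition wcdd A : Prop :=
  [/\ wdd A, J A != finset.set0
    & forall i, i \notin J A -> walks_to_J A i !=set0].

End DiagonalDominance.

(* Main.v *)
Require Import Defs.
From mathcomp Require Import all_boot all_order all_algebra.
From mathcomp Require Import classical_sets reals.
From mathcomp Require Import complex spectral lra.

(** A diagonal entry b of B >= 0 satisfies b <= rho(B) without Perron-Frobenius:
    b^k <= tr (B^k) <= n rho(B)^k for all k, by Schur triangularization over the
    complex numbers. So a w.d.d. M-matrix has a nonnegative diagonal, and a zero
    diagonal entry would come with a zero row. Conversely, a w.d.d. L-matrix is
    s I - B with B >= 0 of row sums at most s, which bounds rho(B).

    If A is a nonsingular w.d.d. L-matrix and i reaches no vertex of J, let D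
    project onto the set of vertices reachable from i. Then D A = D A D and
    D A 1 = 0, while D and D A have the same row space since A is invertible;
    hence D 1 = 0, a contradiction. Conversely, if A is w.c.d.d. and A x = 0, the
    maximality of |x_i| propagates along walks and cannot hold in J. *)

Set Implicit Arguments.
Unset Strict Implicit.
Unset Printing Implicit Defensive.

Import Order.TTheory GRing.Theory Num.Theory.

Local Open Scope ring_scope.

(** * Eigenvalue bounds from row sums and traces of powers *)

Lemma eigenvalue_norm_le (C : numFieldType) (n : nat) (M : 'M[C]_n) (l c : C) :
  (forall i, \sum_j `|M i j| <= c) -> eigenvalue M l -> `|l| <= c.
Proof.
move=> Mc /eigenvalueP[v vM v0].
(* Eigenvectors are row vectors here, so the l1 norm of [v] is what brings out row sums of [M]. *)
have vpos : 0 < \sum_j `|v 0 j|.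
  rewrite lt_def sumr_ge0 ?andbT//; apply: contra v0 => /eqP v0.
  apply/eqP/rowP => j; rewrite mxE; apply/eqP; rewrite -normr_eq0.
  by move/eqP: v0; rewrite psumr_eq0// => /allP/(_ j); rewrite mem_index_enum; apply.
rewrite -(ler_pM2r vpos) mulr_sumr.
have le1 j : `|l| * `|v 0 j| <= \sum_i `|v 0 i| * `|M i j|.
  have <- : `|(v *m M) 0 j| = `|l| * `|v 0 j| by rewrite vM mxE normrM.
  rewrite mxE (le_trans (ler_norm_sum _ _ _))//.
  by apply: ler_sum => i _; rewrite normrM.
apply: (@le_trans _ _ (\sum_j \sum_i `|v 0 i| * `|M i j|)).
  by apply: ler_sum => j _; exact: le1.
rewrite exchange_big mulr_sumr; apply: ler_sum => i _ /=.
by rewrite -mulr_sumr mulrC ler_wpM2r.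
Qed.

Lemma trig_mxM (V : pzSemiRingType) (n : nat) (S T : 'M[V]_n) :
  is_trig_mx S -> is_trig_mx T ->
  is_trig_mx (S *m T) /\ forall i, (S *m T) i i = S i i * T i i.
Proof.
move=> /is_trig_mxP St /is_trig_mxP Tt; split=> [|i].
  apply/is_trig_mxP => i j ij; rewrite mxE big1// => k _.
  have [ik|ki] := ltnP i k; first by rewrite St// mul0r.
  by rewrite Tt ?mulr0// (leq_ltn_trans ki).
rewrite mxE (bigD1 i)//= big1 ?addr0// => k; rewrite -val_eqE neq_ltn.
by case/orP=> ?; [rewrite Tt ?mulr0|rewrite St ?mul0r].
Qed.

Lemma trig_mxX (V : pzSemiRingType) (n k : nat) (T : 'M[V]_n) :
  is_trig_mx T ->
  is_trig_mx (T ^+ k) /\ forall i, (T ^+ k) i i = T i i ^+ k.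
Proof.
move=> Tt; elim: k => [|k [IHt IHd]].
  by rewrite expr0; split=> [|i]; [exact: scalar_mx_is_trig | rewrite mxE eqxx].
rewrite exprS; have [? d] := trig_mxM Tt IHt.
by split=> // i; rewrite d IHd exprS.
Qed.

(** In Schur form the trace is a sum of k-th powers of diagonal entries, and these are eigenvalues
    of [M]. *)
Lemma norm_mxtraceX_le (C : numClosedFieldType) (n k : nat) (M : 'M[C]_n) (s : C) :
  (0 < n)%N -> (forall l, eigenvalue M l -> `|l| <= s) ->
  `|\tr (M ^+ k)| <= n%:R * s ^+ k.
Proof.
move=> n0 Ms; have [P /unitarymx_unit Pu] := Schur M n0.
rewrite /similar_to; set T := mxred.conjmx P M => Tt.
have eigT i : eigenvalue M (T i i).
  have : eigenvalue T (T i i).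
    rewrite eigenvalue_root_char char_poly_trig// /root horner_prod prodf_seq_eq0.
    by apply/hasP; exists i; rewrite ?mem_index_enum//= hornerXsubC subrr.
  apply: mxred.eigenvalue_conjmx; first exact: stablemx_unit.
  by rewrite row_free_unit.
have MT : P *m M = T *m P by rewrite /T mxred.conjumx// mulmxKV.
have MTk : P *m M ^+ k = T ^+ k *m P.
  elim: k => [|k IHk]; first by rewrite !expr0 mulmx1 mul1mx.
  by rewrite !exprS [M * _]/(_ *m _) [T * _]/(_ *m _) mulmxA MT -mulmxA IHk mulmxA.
have -> : \tr (M ^+ k) = \sum_i T i i ^+ k.
  rewrite -[M ^+ k](mulKmx Pu) MTk mxtrace_mulC -mulmxA mulmxV// mulmx1.
  by apply: eq_bigr => i _; rewrite (trig_mxX k Tt).2.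
apply: (le_trans (ler_norm_sum _ _ _)).
rewrite mulr_natl -[X in _ *+ X]card_ord -sumr_const; apply: ler_sum => i _.
by rewrite normrX lerXn2r ?nnegrE// ?Ms ?(le_trans (normr_ge0 _) (Ms _ (eigT i))).
Qed.

(** If 0 < s < t, Bernoulli's inequality makes (t / s)^k outgrow [c]; s = 0 already fails at k =
    1. *)
Lemma ler_of_geometric_bound (R : archiRealFieldType) (s t c : R) :
  0 <= s -> (forall k, t ^+ k <= c * s ^+ k) -> t <= s.
Proof.
move=> s0 tsk; rewrite leNgt; apply/negP => st.
have t0 : 0 < t := le_lt_trans s0 st.
move: s0; rewrite le_eqVlt => /predU1P[s0|s0].
  by move: (tsk 1%N); rewrite -s0 !expr1 mulr0 leNgt t0.
set e := t / s - 1; have e0 : 0 < e by rewrite subr_gt0 ltr_pdivlMr// mul1r.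
have bern k : 1 + k%:R * e <= (t / s) ^+ k.
  elim: k => [|k IHk]; first by rewrite mul0r addr0.
  have ts : t / s = 1 + e by rewrite addrC subrK.
  rewrite exprS {1}ts -natr1.
  have k0 : 0 <= k%:R :> R by [].
  have : (1 + e) * (1 + k%:R * e) <= (1 + e) * (t / s) ^+ k.
    by rewrite ler_wpM2l// ltW// addr_gt0.
  nra.
have ck k : k%:R <= c / e.
  rewrite ler_pdivlMr//; apply: (@le_trans _ _ ((t / s) ^+ k)).
    by rewrite (le_trans _ (bern k))// lerDr.
  by rewrite expr_div_n ler_pdivrMr ?exprn_gt0.
have c0 : 0 <= c / e := ck 0%N.
by have := archi_boundP c0; rewrite ltNge ck.
Qed.

Lemma normcE (R : rcfType) (x : R[i]) : `|x| = (Normc.normc x)%:C%C.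
Proof. by []. Qed.

Lemma normr_complex (R : rcfType) (x : R) : `|x%:C%C| = `|x|%:C%C.
Proof. by rewrite normcE /= expr0n/= addr0 sqrtr_sqr. Qed.

Section RealMatrix.
Variables (R : realType) (n : nat).
Implicit Types A B : 'M[R]_n.
Local Open Scope complex_scope.

Lemma eigenvalue_spectral_radius (M : 'M[R[i]]_n) l :
  eigenvalue M l -> Normc.normc l <= spectral_radius M.
Proof.
move=> Ml; apply: ub_le_sup; last by exists l.
(* A supremum bounds its set only if the set is bounded above; the sum of all moduli dominates every
   row sum. *)
exists (\sum_i \sum_j (Normc.normc (M i j) : R)) => _ [m Mm <-].
rewrite -lecR -normcE; apply: eigenvalue_norm_le Mm => i.
rewrite -(rmorph_sum (real_complex R)) lecR.
rewrite [leRHS](bigD1 i)//= lerDl sumr_ge0// => k _; rewrite sumr_ge0// => j _.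
by rewrite -lecR; exact: normr_ge0 (M k j).
Qed.

Lemma nonneg_diag_le_spectral_radius B (i : 'I_n) :
  (forall j k, 0 <= B j k) ->
  B i i <= spectral_radius (map_mx (real_complex R) B).
Proof.
move=> B0; have n0 : (0 < n)%N := leq_ltn_trans (leq0n i) (ltn_ord i).
set M := map_mx _ B; set s := spectral_radius M.
have Ms l : eigenvalue M l -> `|l| <= s%:C.
  by move=> Ml; rewrite normcE lecR eigenvalue_spectral_radius.
have s0 : 0 <= s.
  have [l Ml] := eigenvalue_closed M n0.
  by rewrite -lecR; exact: le_trans (normr_ge0 l) (Ms _ Ml).
apply: (@ler_of_geometric_bound _ _ _ n%:R s0) => k.
have Bk0 m p q : 0 <= (B ^+ m) p q.
  elim: m p q => [|m IHm] p q; first by rewrite expr0 mxE.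
  by rewrite exprS mxE sumr_ge0// => r _; rewrite mulr_ge0.
(* Of the closed walks of length [k] at [i], keep only the one that never leaves [i]. *)
have tk : B i i ^+ k <= (B ^+ k) i i.
  elim: k => [|k IHk]; first by rewrite !expr0 mxE eqxx.
  rewrite !exprS mxE (bigD1 i)//= (le_trans (ler_wpM2l (B0 i i) IHk))//.
  by rewrite lerDl sumr_ge0// => r _; rewrite mulr_ge0.
apply: (le_trans tk); apply: (@le_trans _ _ (\tr (B ^+ k))).
  by rewrite /mxtrace (bigD1 i)//= lerDl sumr_ge0.
apply: le_trans (ler_norm _) _; rewrite -lecR -normr_complex.
have -> : (\tr (B ^+ k))%:C = \tr (M ^+ k).
  have -> : M ^+ k = map_mx (real_complex R) (B ^+ k).
    elim: {tk} k => [|k IHk]; first by rewrite !expr0 map_mx1.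
    by rewrite !exprS [in RHS]map_mxM IHk.
  by rewrite trace_map_mx.
by rewrite (le_trans (norm_mxtraceX_le k n0 Ms))// rmorphM rmorph_nat rmorphXn.
Qed.

(** * M-matrices and L-matrices under weak dominance *)

Lemma wdd_M_matrix_L_matrix A :
  A \in unitmx -> wdd A -> M_matrix A -> L_matrix A.
Proof.
move=> Au Aw [s [B [AE B0 Bs]]]; split=> [i j ij|i].
  by rewrite AE !mxE (negbTE ij) mulr0n sub0r oppr_le0.
have : 0 <= A i i.
  rewrite AE !mxE eqxx mulr1n subr_ge0.
  exact: le_trans (nonneg_diag_le_spectral_radius i B0) Bs.
rewrite le_eqVlt => /predU1P[Aii|//]; have := Aw i.
rewrite -Aii normr0 => Ai0; have rowA0 : row i A = 0.
  apply/rowP => j; rewrite !mxE; have [->//|ji] := eqVneq j i.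
  apply/eqP; rewrite -normr_eq0 eq_le normr_ge0 andbT.
  apply: le_trans Ai0; rewrite (bigD1 j)//= lerDl; exact: sumr_ge0.
(* The i-th unit row vector is sent to row [i], which is zero; cancelling [A] makes it zero too. *)
have := mulmxK Au (delta_mx 0 i : 'rV_n).
rewrite -rowE rowA0 mul0mx => /rowP/(_ i).
by rewrite !mxE !eqxx => /eqP; rewrite eq_sym oner_eq0.
Qed.

Lemma wdd_L_matrix_M_matrix A : wdd A -> L_matrix A -> M_matrix A.
Proof.
(* The trace serves as an upper bound of all diagonal entries, in place of their maximum. *)
move=> Aw [AZ A0]; pose s := \sum_i A i i.
have As i : A i i <= s by rewrite /s (bigD1 i)//= lerDl sumr_ge0// => j _; exact: ltW.
have s0 : 0 <= s by rewrite sumr_ge0// => i _; exact: ltW.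
exists s, (s%:M - A); split; first by rewrite subKr.
  move=> i j; rewrite !mxE; have [<-|ij] := eqVneq; first by rewrite subr_ge0.
  by rewrite sub0r oppr_ge0 AZ.
(* Without eigenvalues (n = 0) the supremum takes its default value 0. *)
have [E0|/set0P E0] := eqVneq
  [set Normc.normc l | l in [set l : R[i] |
     eigenvalue (map_mx (real_complex R) (s%:M - A)) l]]%classic set0.
  by rewrite /spectral_radius E0 sup0.
apply: ge_sup => // _ [l Bl <-]; rewrite -lecR -normcE.
apply: eigenvalue_norm_le Bl => i.
(* The term [s - A i i] is the diagonal entry of s I - A; dominance then bounds the rest of the row
   by |A i i|. *)
have -> : s%:C = (s - A i i + `|A i i|)%:C by rewrite gtr0_norm// subrK.
apply: (@le_trans _ _ (\sum_j `|(s%:M - A) i j|)%:C).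
  rewrite (rmorph_sum (real_complex R)); apply: ler_sum => j _ /=.
  by rewrite mxE normr_complex.
rewrite lecR (bigD1 i)//= !mxE eqxx mulr1n ger0_norm ?subr_ge0// lerD2l.
apply: le_trans (Aw i); apply: ler_sum => j ji.
by rewrite !mxE eq_sym (negbTE ji) sub0r normrN.
Qed.

(** * Nonsingularity and walks into [J] *)

Lemma L_matrix_row_sum A i : wdd A -> L_matrix A -> i \notin J A ->
  \sum_j A i j = 0.
Proof.
move=> Aw [AZ A0]; rewrite inE -leNgt => iJ.
(* Outside [J] dominance is an equality, and the signs of an L-matrix turn it into cancellation. *)
have dom : \sum_(j < n | j != i) `|A i j| = A i i.
  by rewrite -[RHS]gtr0_norm//; apply/le_anti; rewrite Aw.
rewrite (bigD1 i)//= -[X in X + _]dom -big_split big1//= => j ji.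
by rewrite ler0_norm ?addNr// AZ// eq_sym.
Qed.

Lemma unit_L_matrix_connect_J A i :
  A \in unitmx -> wdd A -> L_matrix A ->
  exists2 k, k \in J A & connect (digraph A) i k.
Proof.
move=> Au Aw AL; pose S := connect (digraph A) i.
have [/existsP[k /andP[]]|noJ] := boolP [exists k, (k \in J A) && S k].
  by exists k.
have SJ k : S k -> k \notin J A.
  by move=> Sk; apply: contra noJ => kJ; apply/existsP; exists k; rewrite kJ.
pose D : 'M[R]_n := diag_mx (\row_k (S k)%:R).
have DA1 : D *m A *m (const_mx 1 : 'cV_n) = 0.
  apply/colP => k; rewrite -mulmxA mul_diag_mx !mxE.
  have [/SJ kJ|_] := boolP (S k); last by rewrite mul0r.
  rewrite mul1r -[RHS](L_matrix_row_sum Aw AL kJ).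
  by apply: eq_bigr => j _; rewrite mxE mulr1.
(* No edge leaves [S], so a row indexed in [S] vanishes in the columns outside [S]. *)
have DAD : D *m A = D *m A *m D.
  apply/matrixP => p q; rewrite mul_mx_diag mul_diag_mx !mxE.
  have [Sp|_] := boolP (S p); last by rewrite !mul0r.
  have [->|Apq] := eqVneq (A p q) 0; first by rewrite mulr0 mul0r.
  by rewrite /S (connect_trans Sp (connect1 Apq)) mulr1.
(* One inclusion of row spaces and equal ranks, [A] being invertible, give the other inclusion. *)
have : (D <= D *m A)%MS.
  have sub : (D *m A <= D)%MS by rewrite DAD submxMl.
  have [_ /esym] := mxrank_leqif_eq sub.
  by rewrite mxrankMfree ?row_free_unit// eqxx => /andP[].
move=> /submxP[X DE]; have : D *m (const_mx 1 : 'cV_n) = 0.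
  by rewrite DE -mulmxA DA1 mulmx0.
move=> /colP/(_ i); rewrite mul_diag_mx !mxE /S connect0 mulr1.
by move/eqP; rewrite oner_eq0.
Qed.

Lemma unit_L_matrix_wcdd A : (0 < n)%N ->
  A \in unitmx -> wdd A -> L_matrix A -> wcdd A.
Proof.
move=> n0 Au Aw AL; split=> // [|i iJ].
  have [k kJ _] := unit_L_matrix_connect_J (Ordinal n0) Au Aw AL.
  by apply/set0Pn; exists k.
have [k kJ /connectP[[|j p] ip kE]] := unit_L_matrix_connect_J i Au Aw AL.
  (* An empty path would put [i] in [J], so the walk has at least two vertices. *)
  by rewrite kE (negbTE iJ) in kJ.
by rewrite kE in kJ; exists (i :: j :: p).
Qed.

End RealMatrix.

(* At a vertex where |x| is maximal, A x = 0 forces equality in the dominance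
   inequality, so the vertex is outside J and every neighbour is maximal too. *)
Lemma wcdd_unit (K : realFieldType) (n : nat) (A : 'M[K]_n) :
  wcdd A -> A \in unitmx.
Proof.
(* Transposing turns the row kernel into the solutions of A x = 0. *)
move=> [Aw _ AJ]; rewrite -unitmx_tr -row_free_unit -kermx_eq0.
apply/rowV0P => y /sub_kermxP yA; apply/eqP; apply/negPn/negP => y0.
have /rV0Pn[i0 yi0] := y0.
pose i := [arg max_(k > i0) `|y 0 k|]%O.
have yM j : `|y 0 j| <= `|y 0 i|.
  by rewrite /i; case: arg_maxP => // k _; apply.
have yi : 0 < `|y 0 i| by rewrite (lt_le_trans _ (yM i0))// normr_gt0.
pose maximal k := `|y 0 k| == `|y 0 i|.
have Ay k : A k k * y 0 k = - \sum_(j < n | j != k) A k j * y 0 j.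
  move/rowP/(_ k): yA; rewrite !mxE (bigD1 k)//= mxE mulrC => /eqP.
  rewrite addr_eq0 => /eqP ->; congr (- _).
  by apply: eq_bigr => j _; rewrite mxE mulrC.
(* The left side has nonnegative terms and the right side is nonpositive by dominance, so both
   vanish. *)
have Amax k : maximal k ->
    \sum_(j < n | j != k) `|A k j| * (`|y 0 i| - `|y 0 j|) <=
    (\sum_(j < n | j != k) `|A k j| - `|A k k|) * `|y 0 i|.
  move=> /eqP yk; rewrite mulrBl -{3}yk -normrM Ay normrN mulr_suml.
  under eq_bigr do rewrite mulrBr.
  rewrite sumrB lerD2l lerN2; apply: le_trans (ler_norm_sum _ _ _) _.
  by apply: ler_sum => j _; rewrite normrM.
have terms_ge0 k j : 0 <= `|A k j| * (`|y 0 i| - `|y 0 j|).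
  by rewrite mulr_ge0// subr_ge0.
have max_notin_J k : maximal k -> k \notin J A.
  move=> mk; rewrite inE -leNgt -subr_ge0 -(pmulr_lge0 _ yi).
  by rewrite (le_trans _ (Amax k mk))// sumr_ge0.
have max_edge k j : maximal k -> digraph A k j -> maximal j.
  move=> mk Akj; have [->//|jk] := eqVneq j k.
  have : `|A k j| * (`|y 0 i| - `|y 0 j|) <= 0.
    apply: (@le_trans _ _ (\sum_(j < n | j != k) `|A k j| * (`|y 0 i| - `|y 0 j|))).
      by rewrite (bigD1 j)//= lerDl sumr_ge0.
    by rewrite (le_trans (Amax _ mk))// pmulr_lle0// subr_le0.
  rewrite pmulr_rle0 ?normr_gt0// subr_le0 => yj.
  by rewrite /maximal eq_le yM yj.
have max_path k p : maximal k -> path (digraph A) k p -> maximal (last k p).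
  elim: p k => //= j p IHp k mk /andP[kj]; apply: IHp; exact: max_edge kj.
have mi : maximal i := eqxx _.
have [[|k w] [//= _ iw ki]] := AJ i (max_notin_J i mi).
by rewrite ki in iw *; apply/negP/max_notin_J/max_path.
Qed.

Theorem theorem2p24 (R : realType) (n : nat) (hn : (0 < n)%N) (A : 'M[R]_n) :
  ([/\ A \in unitmx, wdd A & M_matrix A] <->
   [/\ A \in unitmx, wdd A & L_matrix A])
  /\
  ([/\ A \in unitmx, wdd A & L_matrix A] <->
   (wcdd A /\ L_matrix A)).
Proof.
split; split=> [[Au Aw AM]|].
- by split=> //; exact: wdd_M_matrix_L_matrix.
- by move=> [Au Aw AL]; split=> //; exact: wdd_L_matrix_M_matrix.
- by split=> //; exact: unit_L_matrix_wcdd.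
- by move=> [Ac AL]; split=> //; [exact: wcdd_unit|case: Ac].
Qed.
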